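(* Let $0\le r<1$, $0<\vartheta<1$, and let $d,n\in\mathbb{N}$ (with $d,n\ge 1$) satisfy $$n<\sqrt{\vartheta 2^{d}}.$$ Then $P(d,r,n)>1-\vartheta$.
   Context: $B_d=\{X\in\mathbb{R}^d:\ \|X\|\le 1\}$ is the Euclidean unit ball centered at the origin, and $rB_d$ is the ball of radius $r$ centered at the origin. $M_n=\{X_1,\ldots,X_n\}$ is a set of $n$ points chosen randomly and independently according to the uniform distribution (normalized Lebesgue measure) on the spherical layer $B_d\setminus rB_d$. A point $X\in\mathbb{R}^d$ is linearly separable from a set $M\subset\mathbb{R}^d$ if there exists $A_X\in\mathbb{R}^d$ such that $(A_X,X)>(A_X,Y)$ for all $Y\in M$, where $(\cdot,\cdot)$ is the standard inner product. A set $\{X_1,\ldots,X_n\}\subset\mathbb{R}^d$ is linearly separable if each point $X_i$ is linearly separable from the set of all the other points. $P(d,r,n)$ denotes the probability that $M_n$ is linearly separable. *)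

(* Defs.v *)
From HB Require Import structures.
From mathcomp Require Import all_boot all_order all_algebra.
From mathcomp Require Import all_classical all_reals all_analysis.

Set Implicit Arguments.
Unset Strict Implicit.
Unset Printing Implicit Defensive.

Import Order.TTheory GRing.Theory Num.Theory.

Local Open Scope classical_set_scope.
Local Open Scope ring_scope.

(* R^d is represented by [d.-tuple R], which carries
   the product (Borel) sigma-algebra; ['rV[R]_d] has no measurable structure
   and its norm is the sup norm. *)

Section lebesgue_vec.
Context {R : realType}.

Definition cons_vec d (p : R * d.-tuple R) : d.+1.-tuple R :=
  [tuple of p.1 :: p.2].

Lemma measurable_cons_vec d : measurable_fun setT (@cons_vec d).
Proof. exact: measurable_cons. Qed.

Let uncons_vec d (x : d.+1.-tuple R) : R * d.-tuple R :=
  (tnth x ord0, [tuple of behead x]).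

Let measurable_uncons_vec d : measurable_fun setT (@uncons_vec d).
Proof.
by apply/measurable_fun_pairP; split;
  [exact: measurable_tnth|exact: measurable_behead].
Qed.

Let cons_vecK d : cancel (@cons_vec d) (@uncons_vec d).
Proof. by move=> [a x]; congr pair; apply: val_inj. Qed.

Section lebesgue_cons.
Context d (m : {sigma_finite_measure set (d.-tuple R) -> \bar R}).

Definition lebesgue_cons : set (d.+1.-tuple R) -> \bar R :=
  pushforward (lebesgue_measure \x m)%E (@cons_vec d).

Let lebesgue_cons0 : lebesgue_cons set0 = 0%E.
Proof. by rewrite /lebesgue_cons /pushforward preimage_set0 measure0. Qed.

Let lebesgue_cons_ge0 A : (0 <= lebesgue_cons A)%E.
Proof. by rewrite /lebesgue_cons /pushforward; exact: measure_ge0. Qed.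

Let lebesgue_cons_sigma_additive : semi_sigma_additive lebesgue_cons.
Proof.
move=> F mF tF mUF; rewrite /lebesgue_cons /pushforward preimage_bigcup.
apply: measure_semi_sigma_additive.
- by move=> n; rewrite -[X in measurable X]setTI; exact: measurable_cons_vec.
- apply/trivIsetP => /= i j _ _ ij; rewrite -preimage_setI.
  by move/trivIsetP : tF => /(_ _ _ _ _ ij) ->//; rewrite preimage_set0.
- rewrite -preimage_bigcup -[X in measurable X]setTI.
  exact: measurable_cons_vec.
Qed.

HB.instance Definition _ := isMeasure.Build _ _ _ lebesgue_cons
  lebesgue_cons0 lebesgue_cons_ge0 lebesgue_cons_sigma_additive.

(* The canonical sigma-finite structure of [\x] only covers products of
   subprobabilities, hence a direct proof. *)
Let lebesgue_cons_sigma_finite : sigma_finite setT lebesgue_cons.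
Proof.
have /sigma_finiteP[F [FT ndF mF]] := sigma_finiteT (@lebesgue_measure R).
have /sigma_finiteP[G [GT ndG mG]] := sigma_finiteT m.
exists (fun k => @uncons_vec d @^-1` (F k `*` G k)).
  rewrite -preimage_bigcup -(@preimage_setT _ _ (@uncons_vec d)).
  congr (_ @^-1` _); apply/seteqP; split => // -[a x] _.
  have [[i _ Fa] [j _ Gx]] : (\bigcup_k F k) a /\ (\bigcup_k G k) x.
    by rewrite -FT -GT.
  exists (maxn i j) => //; split => /=.
  - by move: a Fa; exact/subsetPset/ndF/leq_maxl.
  - by move: x Gx; exact/subsetPset/ndG/leq_maxr.
move=> k; have [mFk Fk] := mF k; have [mGk Gk] := mG k; split.
  rewrite -[X in measurable X]setTI; apply: measurable_uncons_vec => //.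
  exact: measurableX.
rewrite /lebesgue_cons /pushforward -comp_preimage.
rewrite (_ : _ \o _ = id); last by apply/funext => p /=; rewrite cons_vecK.
by rewrite preimage_id product_measure1E// lte_mul_pinfty// ge0_fin_numE.
Qed.

HB.instance Definition _ := Measure_isSigmaFinite.Build _ _ _ lebesgue_cons
  lebesgue_cons_sigma_finite.

End lebesgue_cons.

(* Lebesgue measure on R^d, as the d-fold product of [lebesgue_measure]; on
   the one-point space R^0 it is the unit point mass. *)
Fixpoint lebesgue_vec d : {sigma_finite_measure set (d.-tuple R) -> \bar R} :=
  match d with
  | 0%N => \d_([tuple] : 0.-tuple R)
  | d'.+1 => lebesgue_cons (lebesgue_vec d')
  end.

Lemma lebesgue_vec_box d (A : 'I_d -> set R) :
  (forall i, measurable (A i)) ->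
  lebesgue_vec d [set x | forall i, A i (tnth x i)] =
  (\prod_(i < d) lebesgue_measure (A i))%E.
Proof.
elim: d A => [|d IH] A mA /=.
  by rewrite big_ord0 /dirac indicE mem_set// => -[].
rewrite big_ord_recl -IH; last by move=> i; exact: mA.
rewrite /lebesgue_cons /pushforward -product_measure1E//=; last first.
  rewrite (_ : mkset _ = \bigcap_(i in [set: 'I_d])
      ((fun x : d.-tuple R => tnth x i) @^-1` A (lift ord0 i))); last first.
    by apply/seteqP; split => x /= xA i; [move=> _|]; exact: xA.
  apply: fin_bigcap_measurable => // i _.
  by rewrite -[X in measurable X]setTI; exact: measurable_tnth.
  exact: mA.
congr (product_measure1 _ _ _).
apply/seteqP; split => [[a x] /= ax|[a x] [/= Aa Ax] i].
  split => /=; first exact: (ax ord0).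
  by move=> i; have := ax (lift ord0 i); rewrite tnthS.
by have [j|] := unliftP ord0 i => ->; rewrite ?tnthS//; exact: Ax.
Qed.

End lebesgue_vec.

Section geometry.
Context {R : realType} {d : nat}.
Implicit Types (x y a : d.-tuple R) (M : set (d.-tuple R)) (r : R).

Definition dotp x y : R := \sum_(i < d) tnth x i * tnth y i.

Definition enorm x : R := Num.sqrt (dotp x x).

Definition eball r : set (d.-tuple R) := [set x | enorm x <= r].

Definition layer r : set (d.-tuple R) := eball 1 `\` eball r.

Definition separable_from x M :=
  exists a, forall y, M y -> dotp a x > dotp a y.

(* The points are indexed: [X j] counts as another point than [X i] as soon as
   [j != i], so a family with repeated values is not separable. *)
Definition linearly_separable n (X : 'I_n -> d.-tuple R) :=
  forall i, separable_from (X i) [set X j | j in [set j | j != i]].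

End geometry.

Section randomness.
Local Open Scope ereal_scope.
Context {dO : measure_display} {Omega : measurableType dO} {R : realType}.
Variable P : probability Omega R.

Definition mutually_independent d' (T : measurableType d') n
    (X : 'I_n -> {RV P >-> T}) :=
  forall (J : {set 'I_n}) (A : 'I_n -> set T),
    (forall i, measurable (A i)) ->
    P (\bigcap_(i in [set i | i \in J]) (X i @^-1` A i)) =
    \prod_(i in J) P (X i @^-1` A i).

Definition uniform_on d (D : set (d.-tuple R)) (X : {RV P >-> d.-tuple R}) :=
  forall A, measurable A ->
    distribution P X A =
    ((fine (lebesgue_vec d D))^-1)%:E * lebesgue_vec d (A `&` D).

End randomness.

(* Main.v *)
(* If X_i is not separable from the other points then the normal X_i itself
   fails, so (X_i, X_i) <= (X_j, X_i) for some j <> i: the point X_i lies in the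
   ball with diameter [0, X_j], whose volume is at most 2^-d vol(B_d). This ball
   is star-shaped about 0, hence scaling by r shows that its part inside r B_d
   has at least the fraction r^d of the volume of its part inside B_d; its part
   in the layer therefore has at most 2^-d times the volume of the layer. By
   independence and the union bound the probability of non-separability is at
   most n^2 2^-d < theta. *)
From HB Require Import structures.
Require Import Defs.
From mathcomp Require Import all_boot all_order all_algebra.
From mathcomp Require Import all_classical all_reals all_analysis.
From mathcomp Require Import measurable_realfun lra ring.
Import Order.TTheory GRing.Theory Num.Theory.
Local Open Scope classical_set_scope.
Local Open Scope ring_scope.

(** * Lebesgue measure under homotheties and translations *)

Lemma measurable_affine {R : realType} (c v : R) :
  measurable_fun setT (fun x : R => c * x + v).
Proof. by apply: measurable_funD => //; exact: measurable_funM. Qed.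

(** The right-hand side is a measure in [A], so uniqueness of Lebesgue measure reduces the claim to
    intervals []a, b]], whose preimage is an interval of length (b - a) / c. *)
Lemma lebesgue_measure_affine {R : realType} (c v : R) (A : set R) :
  0 < c -> measurable A ->
  lebesgue_measure A =
  (c%:E * lebesgue_measure ((fun x => c * x + v)%R @^-1` A))%E.
Proof.
move=> c0 mA.
pose phi : measurableTypeR R -> measurableTypeR R := fun x => c * x + v.
have mphi : measurable_fun setT phi by exact: measurable_affine.
pose phi' : {mfun _ >-> _} :=
  HB.pack phi (isMeasurableFun.Build _ _ _ _ _ mphi).
rewrite (@lebesgue_measure_unique _
  (mscale (NngNum (ltW c0)) (pushforward lebesgue_measure phi')))//.
move=> _ [[a b]] _ <-.
rewrite [RHS]/(c%:E * lebesgue_measure (phi @^-1` `]a, b]%classic))%E.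
rewrite (_ : _ @^-1` _ = `](a - v) / c, (b - v) / c]%classic); last first.
  apply/seteqP; split => x /=; rewrite !in_itv/= /phi/= ltr_pdivrMr//
    ler_pdivlMr// ltrBlDr lerBrDr (mulrC x)//.
rewrite !lebesgue_measure_itv/= !lte_fin ltr_pM2r ?invr_gt0// ltrD2r.
case: ifPn => ab; last by rewrite /= mulr0.
by rewrite -EFinB; congr EFin; field; rewrite gt_eqF.
Qed.

(** Lebesgue measure is [c] times its image under x -> c x + v, so this is the integral against an
    image measure. *)
Lemma ge0_integral_affine {R : realType} (c v : R) (f : R -> \bar R) :
  0 < c -> measurable_fun setT f -> (forall x, 0 <= f x)%E ->
  (\int[lebesgue_measure]_x f x =
   c%:E * \int[lebesgue_measure]_x f (c * x + v)%R)%E.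
Proof.
move=> c0 mf f0.
pose phi : measurableTypeR R -> measurableTypeR R := fun x => c * x + v.
have mphi : measurable_fun setT phi by exact: measurable_affine.
pose phi' : {mfun _ >-> _} :=
  HB.pack phi (isMeasurableFun.Build _ _ _ _ _ mphi).
rewrite (eq_measure_integral
  (mscale (NngNum (ltW c0)) (pushforward lebesgue_measure phi'))).
  by rewrite ge0_integral_mscale// ge0_integral_pushforward.
by move=> A mA _; exact: lebesgue_measure_affine.
Qed.

Definition affine_vec {R : realType} {d : nat} (c : R) (v x : d.-tuple R) :
  d.-tuple R := [tuple c * tnth x i + tnth v i | i < d].

Lemma measurable_affine_vec {R : realType} {d : nat} (c : R) (v : d.-tuple R) :
  measurable_fun setT (affine_vec c v).
Proof.
apply/measurable_fun_tnthP => i.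
apply: (eq_measurable_fun (fun x => c * tnth x i + tnth v i)).
  by move=> x _ /=; rewrite tnth_mktuple.
apply: (@measurableT_comp _ _ _ _ _ _ (fun y => c * y + tnth v i)).
  exact: measurable_affine.
exact: measurable_tnth.
Qed.

Lemma affine_vec_cons {R : realType} {d : nat} (c : R) (v : d.+1.-tuple R)
    (a : R) (x : d.-tuple R) :
  affine_vec c v (cons_vec (a, x)) =
  cons_vec (c * a + tnth v ord0, affine_vec c [tuple of behead v] x).
Proof.
apply: eq_from_tnth => i; rewrite tnth_mktuple.
have [j|] := unliftP ord0 i => ->; last by [].
rewrite !tnthS tnth_mktuple tnth_behead; congr (_ + tnth v _).
by apply: val_inj; rewrite /= inordK// ltnS.
Qed.

(** Induction on the dimension: the volume is the integral of the volumes of the sections over the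
    first coordinate. Substitution in that coordinate gives one factor [c], and the induction
    hypothesis on each section gives the other d factors. *)
Lemma lebesgue_vec_affine {R : realType} {d : nat} (c : R) (v : d.-tuple R)
    (A : set (d.-tuple R)) :
  0 < c -> measurable A ->
  lebesgue_vec d A =
  ((c ^+ d)%:E * lebesgue_vec d (affine_vec c v @^-1` A))%E.
Proof.
move=> c0; elim: d v A => [|d IH] v A mA.
  (* R^0 has a single point, so the map is the identity there. *)
  rewrite expr0 mul1e; congr (lebesgue_vec _ _).
  by apply/seteqP; split => x /=; rewrite [affine_vec _ _ _]tuple0 [x]tuple0.
have mcons B : measurable B -> measurable (@cons_vec R d @^-1` B).
  by move=> mB; rewrite -[X in measurable X]setTI; exact: measurable_cons_vec.
have mA' : measurable (affine_vec c v @^-1` A).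
  by rewrite -[X in measurable X]setTI; exact: measurable_affine_vec.
rewrite /= /lebesgue_cons /pushforward /product_measure1.
have mf := measurable_fun_xsection (lebesgue_vec d) (mcons _ mA).
have mf' := measurable_fun_xsection (lebesgue_vec d) (mcons _ mA').
rewrite (ge0_integral_affine _ (tnth v ord0) _ c0 mf)//.
rewrite exprS EFinM -muleA; congr (_ * _)%E.
rewrite -ge0_integralZl_EFin ?exprn_ge0 ?ltW//.
apply: eq_integral => x _ /=.
rewrite [LHS](IH [tuple of behead v]); last exact: (measurable_xsection _ (mcons _ mA)).
congr (_ * lebesgue_vec _ _)%E.
by apply/seteqP; split => y /=; rewrite /xsection/= !inE/= affine_vec_cons.
Qed.

(** * Measurability of conditions on inner products *)

Lemma measurable_dotp {R : realType} (d : nat) (dO : measure_display)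
    (T : measurableType dO) (f g : T -> d.-tuple R) :
  measurable_fun setT f -> measurable_fun setT g ->
  measurable_fun setT (fun w => dotp (f w) (g w)).
Proof.
move=> /measurable_fun_tnthP mf /measurable_fun_tnthP mg.
by apply: measurable_sum => i; apply: measurable_funM; [exact: mf|exact: mg].
Qed.

Lemma measurable_bool_set (dO : measure_display) (T : measurableType dO)
    (f : T -> bool) : measurable_fun setT f -> measurable [set x | f x].
Proof. by move=> /(_ measurableT [set true]); rewrite setTI; exact. Qed.

(** * Volumes of balls and of their parts in the layer *)

Section geometry.
Context {R : realType} {d : nat}.
Implicit Types (x y v : d.-tuple R) (r c : R).

Lemma dotpC x y : dotp x y = dotp y x.
Proof. by apply: eq_bigr => i _; rewrite mulrC. Qed.

Lemma dotp_ge0 x : 0 <= dotp x x.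
Proof. by apply: sumr_ge0 => i _; rewrite -expr2 sqr_ge0. Qed.

Lemma dotp_affine c v x y :
  dotp (affine_vec c v x) y = c * dotp x y + dotp v y.
Proof.
rewrite /dotp mulr_sumr -big_split; apply: eq_bigr => i _ /=.
by rewrite tnth_mktuple mulrDl mulrA.
Qed.

Definition vec0 : d.-tuple R := [tuple 0 | _ < d].

Lemma dotp0 y : dotp vec0 y = 0.
Proof. by rewrite /dotp big1// => i _; rewrite tnth_mktuple mul0r. Qed.

Lemma dotp_scale c x y : dotp (affine_vec c vec0 x) y = c * dotp x y.
Proof. by rewrite dotp_affine dotp0 addr0. Qed.

Lemma eballE r : 0 <= r ->
  eball r = [set x | dotp x x <= r ^+ 2] :> set (d.-tuple R).
Proof.
move=> r0; apply/funext => x; rewrite /eball/= /enorm -[X in _ <= X](ger0_norm r0) -sqrtr_sqr.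
by rewrite ler_sqrt ?sqr_ge0.
Qed.

Lemma measurable_eball r : measurable (@eball R d r).
Proof.
have [r0|r0] := leP 0 r; last first.
  rewrite (_ : eball r = set0)//; apply/seteqP; split=> // x; rewrite /eball/=.
  by move=> /(le_trans (sqrtr_ge0 _)); rewrite leNgt r0.
rewrite eballE//; apply: measurable_bool_set; apply: measurable_fun_ler => //.
exact: measurable_dotp.
Qed.

Lemma measurable_layer r : measurable (@layer R d r).
Proof. by apply: measurableD; exact: measurable_eball. Qed.

Lemma lebesgue_vec_eball r :
  0 < r ->
  (lebesgue_vec d (eball r) = (r ^+ d)%:E * lebesgue_vec d (eball 1))%E.
Proof.
move=> r0; rewrite (lebesgue_vec_affine _ vec0 _ r0); last first.
  exact: measurable_eball.
congr (_ * lebesgue_vec _ _)%E; rewrite !eballE ?ltW//.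
apply/funext => x /=; rewrite dotp_scale dotpC dotp_scale mulrA -expr2 expr1n.
by rewrite -{2}(mulr1 (r ^+ 2)) ler_pM2l ?exprn_gt0.
Qed.

(** The ball lies in a cube of side 2r. This crude bound serves to show that volumes are finite and
    that the ball of radius 0 is null when d > 0. *)
Lemma lebesgue_vec_eball_le r :
  0 <= r -> (lebesgue_vec d (eball r) <= ((2 * r) ^+ d)%:E)%E.
Proof.
move=> r0.
pose B := [set x : d.-tuple R | forall i, `[- r, r]%classic (tnth x i)].
have mB : measurable B.
  rewrite (_ : B = \bigcap_(i in [set: 'I_d])
      ((fun x : d.-tuple R => tnth x i) @^-1` `[- r, r]%classic)).
    apply: fin_bigcap_measurable => // i _.
    by rewrite -[X in measurable X]setTI; exact: measurable_tnth.
  by apply/seteqP; split => x /= xA i; [move=> _|]; exact: xA.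
have -> : (((2 * r) ^+ d)%:E = lebesgue_vec d B)%E.
  rewrite (lebesgue_vec_box (A := fun=> `[- r, r]%classic))//.
  rewrite (eq_bigr (fun=> (2 * r)%:E)).
    by rewrite prodEFin prodr_const card_ord.
  move=> i _; rewrite lebesgue_measure_itv/= lte_fin.
  case: ltP => rr; first by rewrite -EFinB; congr EFin; lra.
  by congr EFin; lra.
apply: le_measure; rewrite ?inE//; first exact: measurable_eball.
move=> x; rewrite eballE//= => xr i /=; rewrite in_itv/=.
rewrite -ler_norml -[X in _ <= X](ger0_norm r0) -ler_sqr ?nnegrE//.
rewrite !real_normK ?num_real//.
apply: le_trans xr; rewrite /dotp (bigD1 i)//= -expr2 lerDl.
by apply: sumr_ge0 => j _; rewrite -expr2 sqr_ge0.
Qed.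

Lemma lebesgue_vec_eball_fin r :
  0 <= r -> lebesgue_vec d (eball r) \is a fin_num.
Proof.
move=> r0; rewrite ge0_fin_numE//.
by rewrite (le_lt_trans (lebesgue_vec_eball_le _ r0))// ltry.
Qed.

(* By Thales' theorem, the ball with diameter [0, x]. *)
Definition thales x : set (d.-tuple R) := [set y | dotp y y <= dotp x y].

Lemma measurable_thales x : measurable (thales x).
Proof.
apply: measurable_bool_set.
by apply: measurable_fun_ler; exact: measurable_dotp.
Qed.

(** Under y -> (y + x) / 2, which has ratio 1/2, the condition defining [thales x] pulls back to |y|
    <= |x|, and |x| <= 1. *)
Lemma lebesgue_vec_thales x : eball 1 x ->
  (lebesgue_vec d (thales x) <= (2^-1 ^+ d)%:E * lebesgue_vec d (eball 1))%E.
Proof.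
move=> x1.
have {}x1 : dotp x x <= 1 by move: x1; rewrite eballE//= expr1n.
pose v := affine_vec 2^-1 vec0 x.
rewrite (lebesgue_vec_affine 2^-1 v)//; last exact: measurable_thales.
rewrite lee_wpmul2l ?lee_fin ?exprn_ge0//; apply: le_measure; rewrite ?inE.
- rewrite -[X in measurable X]setTI; apply: (measurable_affine_vec _ _ measurableT).
  exact: measurable_thales.
- exact: measurable_eball.
move=> y; rewrite eballE//= /thales/= expr1n.
rewrite dotp_affine (dotpC y) (dotpC v) (dotpC x) !dotp_affine (dotpC y v).
rewrite /v !dotp_scale (dotpC x (affine_vec _ _ _)) dotp_scale !dotp0 (dotpC y x); lra.
Qed.

(** Star-shapedness about 0: |r y|^2 = r (r |y|^2) <= r |y|^2 <= r (x, y) = (x, r y). *)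
Lemma thales_scale r x y : 0 <= r <= 1 ->
  thales x y -> thales x (affine_vec r vec0 y).
Proof.
move=> /andP[r0 r1]; rewrite /thales/= => xy.
rewrite dotp_scale (dotpC y) (dotpC x) !dotp_scale (dotpC y x).
by rewrite ler_wpM2l// (le_trans _ xy)// ler_piMl ?dotp_ge0.
Qed.

Lemma lebesgue_vec_thales_layer r x : (0 < d)%N -> 0 <= r < 1 -> eball 1 x ->
  (lebesgue_vec d (thales x `&` layer r) <=
   (2^-1 ^+ d)%:E * lebesgue_vec d (layer r))%E.
Proof.
move=> d0 /andP[r0 r1] x1.
have mE := measurable_eball; have mT := measurable_thales x.
set K := thales x `&` eball 1.
have mK : measurable K by exact: measurableI.
(* Finiteness of the volumes lets set differences become differences of real numbers. *)
have finle (A : set (d.-tuple R)) (s : R) : measurable A -> 0 <= s -> A `<=` eball s ->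
    lebesgue_vec d A \is a fin_num.
  move=> mA s0 As; rewrite ge0_fin_numE//.
  have := lebesgue_vec_eball_fin _ s0; rewrite ge0_fin_numE//.
  by apply: le_lt_trans; apply: le_measure; rewrite ?inE.
(* For r > 0 the preimage of the intersection of [K] with [eball r] under y -> r y contains [K]. For
   r = 0 the left side vanishes because d > 0. *)
have Kr : ((r ^+ d)%:E * lebesgue_vec d K <= lebesgue_vec d (K `&` eball r))%E.
  move: r0; rewrite le_eqVlt => /predU1P[<-|r0].
    by rewrite expr0n eqn0Ngt d0 mul0e.
  rewrite (lebesgue_vec_affine r vec0 (K `&` _))//; last exact: measurableI.
  rewrite lee_wpmul2l ?lee_fin ?exprn_ge0 ?(ltW r0)//.
  apply: le_measure; rewrite ?inE//.
    rewrite -[X in measurable X]setTI.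
    apply: (measurable_affine_vec _ _ measurableT).
    exact: measurableI.
  move=> y [xy y1]; split; first split.
  - by apply: thales_scale => //; rewrite !ltW.
  - move: y1; rewrite !eballE//= dotp_scale dotpC dotp_scale expr1n => y1.
    by rewrite mulrA -expr2 mulr_ile1 ?sqr_ge0 ?dotp_ge0// expr_le1 ?ltW.
  - move: y1; rewrite !eballE ?ltW//= dotp_scale dotpC dotp_scale expr1n => y1.
    by rewrite mulrA -expr2 ler_piMr ?sqr_ge0.
have Er :
    (lebesgue_vec d (eball r) <= (r ^+ d)%:E * lebesgue_vec d (eball 1))%E.
  move: r0; rewrite le_eqVlt => /predU1P[<-|r0].
    rewrite (le_trans (lebesgue_vec_eball_le _ (lexx 0)))//.
    by rewrite mulr0 expr0n eqn0Ngt d0 mul0e.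
  by rewrite lebesgue_vec_eball.
have -> : thales x `&` layer r = K `\` eball r by rewrite /layer setIDA.
have Er1 : eball 1 `&` eball r = eball r :> set (d.-tuple R).
  rewrite setIC; apply/setIidPl => y; rewrite /eball/= => /le_trans.
  by apply; exact: ltW.
have K1 : (lebesgue_vec d K <= (2^-1 ^+ d)%:E * lebesgue_vec d (eball 1))%E.
  apply: le_trans (lebesgue_vec_thales _ x1).
  by apply: le_measure; rewrite ?inE//; exact: subIsetl.
have finE := lebesgue_vec_eball_fin.
have finK : lebesgue_vec d K \is a fin_num.
  by apply: (finle _ 1) => //; exact: subIsetr.
have finKr : lebesgue_vec d (K `&` eball r) \is a fin_num.
  by apply: (finle _ r _ r0); [exact: measurableI|exact: subIsetr].
have -> : lebesgue_vec d (K `\` eball r) =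
    (lebesgue_vec d K - lebesgue_vec d (K `&` eball r))%E.
  by apply: measureD => //; have := finK; rewrite ge0_fin_numE.
have -> : lebesgue_vec d (layer r) =
    (lebesgue_vec d (eball 1) - lebesgue_vec d (eball r))%E.
  rewrite -[in RHS]Er1; apply: measureD => //.
  by have := finE 1 ler01; rewrite ge0_fin_numE.
move: Kr Er K1.
rewrite -(fineK (finE 1 ler01)) -(fineK (finE r r0)) -(fineK finK) -(fineK finKr).
rewrite -!EFinB -!EFinM !lee_fin.
(* Write u = r^d, w = 2^-d and let E, E_r, K, K_r be the four volumes. Then K - K_r <= (1 - u) K <=
   (1 - u) w E <= w (E - E_r), using in turn [Kr], [K1] with u <= 1, and [Er]. *)
move: (fine _) (fine _) (fine _) (fine _) => a b e f.
have : 0 < (2^-1 : R) ^+ d by exact: exprn_gt0.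
have : r ^+ d <= 1 by rewrite exprn_ile1// ltW.
have : 0 <= r ^+ d by exact: exprn_ge0.
move: (r ^+ d) (_ ^+ d) => u w u0 u1 w0 h1 h2 h3.
nra.
Qed.

End geometry.

(** * Measurability of the event of separability *)

(* Rational normals suffice, so the event of separability is a countable union
   of measurable sets. *)
Lemma rational_separation {R : realType} (d n : nat) (x a : d.-tuple R)
    (y : 'I_n -> d.-tuple R) (p : pred 'I_n) :
  (forall j, p j -> dotp a (y j) < dotp a x) ->
  exists q : d.-tuple rat, forall j, p j ->
    dotp (map_tuple ratr q) (y j) < dotp (map_tuple ratr q) x.
Proof.
(* Moving each coordinate of [a] by at most 1 / (1 + T) changes the gap [delta j] by at most S_j /
   (1 + T). This is less than [delta j], because S_j / delta_j is one of the nonnegative terms of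
   [T]. The summand 1 makes the denominator positive even if [T] is 0. *)
move=> ax; pose delta j := dotp a x - dotp a (y j).
pose S j := \sum_(k < d) `|tnth x k - tnth (y j) k|.
pose T := \sum_(j | p j) S j / delta j.
have delta0 j : p j -> 0 < delta j by move=> pj; rewrite subr_gt0 ax.
have S0 j : 0 <= S j by exact: sumr_ge0.
have Sd0 j : p j -> 0 <= S j / delta j.
  by move=> pj; rewrite divr_ge0// ltW// delta0.
have T0 : 0 < 1 + T by rewrite ltr_pwDl// sumr_ge0.
have /fin_all_exists[q aq] (k : 'I_d) :
    exists q : rat, `|ratr q - tnth a k| <= (1 + T)^-1.
  have [|q] := @rat_in_itvoo R (tnth a k) (tnth a k + (1 + T)^-1).
    by rewrite ltrDl invr_gt0.
  rewrite in_itv/= => /andP[aq qa]; exists q.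
  by rewrite ger0_norm ?subr_ge0 ?ltW// ltrBlDl.
exists [tuple q k | k < d] => j pj.
set b := map_tuple _ _.
have bE k : tnth b k = ratr (q k) by rewrite tnth_map tnth_mktuple.
have diffE u : dotp u x - dotp u (y j) =
    \sum_(k < d) tnth u k * (tnth x k - tnth (y j) k).
  by rewrite /dotp -sumrB; apply: eq_bigr => k _; rewrite mulrBr.
have : `|(dotp b x - dotp b (y j)) - delta j| <= (1 + T)^-1 * S j.
  rewrite /delta !diffE -sumrB mulr_sumr (le_trans (ler_norm_sum _ _ _))//.
  apply: ler_sum => k _; rewrite -mulrBl normrM bE.
  by rewrite ler_wpM2r.
have : (1 + T)^-1 * S j < delta j.
  rewrite mulrC ltr_pdivrMr// -ltr_pdivrMl ?delta0// mulrC.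
  rewrite /T (bigD1 j)//= addrCA ltrDl ltr_pwDl// sumr_ge0// => i /andP[pi _].
  exact: Sd0.
rewrite -subr_gt0 ler_norml; lra.
Qed.

Lemma measurable_linearly_separable {R : realType} (d n : nat)
    (dO : measure_display) (T : measurableType dO)
    (X : 'I_n -> T -> d.-tuple R) :
  (forall i, measurable_fun setT (X i)) ->
  measurable [set w | linearly_separable (fun i => X i w)].
Proof.
move=> mX.
rewrite (_ : mkset _ = \bigcap_(i in [set: 'I_n])
    \bigcup_(q in [set: d.-tuple rat])
    \bigcap_(j in [set j | j != i])
      [set w | dotp (map_tuple ratr q) (X j w) <
               dotp (map_tuple ratr q) (X i w)]).
  apply: fin_bigcap_measurable => // i _.
  apply: countable_bigcupT_measurable => // q.
  apply: fin_bigcap_measurable => [|j _]; first exact: finite_finset.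
  apply: measurable_bool_set.
  by apply: measurable_fun_ltr; exact: measurable_dotp.
apply/seteqP; split => w /= H i.
  move=> _; have [a Ha] := H i.
  have [|q Hq] :=
    @rational_separation R d n (X i w) a (X ^~ w) [pred j | j != i].
    by move=> j ji; apply: Ha; exists j.
  by exists q => // j; exact: Hq.
have [//|q _ Hq] := H i.
by exists (map_tuple ratr q) => _ [j ji <-]; exact: Hq.
Qed.

(** * Union bound and estimates for one or two random points *)

Lemma measure_bigsetU_le {R : realType} (dO : measure_display)
    (T : measurableType dO) (mu : {measure set T -> \bar R}) (I : Type)
    (s : seq I) (F : I -> set T) :
  (forall i, measurable (F i)) ->
  (mu (\big[setU/set0]_(i <- s) F i) <= \sum_(i <- s) mu (F i))%E.
Proof.
move=> mF; elim: s => [|i s IH]; first by rewrite !big_nil measure0.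
rewrite !big_cons (le_trans (measureU2 _ _ _))//; last exact: leeD2l.
exact: bigsetU_measurable.
Qed.

Section random_points.
Context {R : realType} {d : nat} {dO : measure_display}
  {Omega : measurableType dO} {P : probability Omega R}.
Implicit Types (X Y : {RV P >-> d.-tuple R}) (r : R).

Lemma uniform_on_layer_eball X r :
  uniform_on (layer r) X -> P (X @^-1` ~` eball 1) = 0%E.
Proof.
move=> /(_ (~` eball 1)); rewrite /distribution /pushforward => ->.
  rewrite (_ : _ `&` _ = set0) ?measure0 ?mule0//.
  by rewrite /layer setDE setIA setICl set0I.
by apply: measurableC; exact: measurable_eball.
Qed.

Lemma uniform_on_layer_thales X r x : (0 < d)%N -> 0 <= r < 1 -> eball 1 x ->
  uniform_on (layer r) X ->
  (P (X @^-1` thales x) <= (2^-1 ^+ d)%:E)%E.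
Proof.
move=> d0 r01 x1 /(_ (thales x) (measurable_thales x)).
rewrite /distribution /pushforward => ->.
have Vfin : lebesgue_vec d (layer r) \is a fin_num.
  have := lebesgue_vec_eball_fin (d:=d) _ (@ler01 R); rewrite !ge0_fin_numE//.
  apply: le_lt_trans; apply: le_measure; rewrite ?inE; first exact: measurable_layer.
    exact: measurable_eball.
  exact: subDsetl.
have := lebesgue_vec_thales_layer _ _ d0 r01 x1.
have : (0 <= lebesgue_vec d (layer r))%E by [].
rewrite -(fineK Vfin); set V := fine _; rewrite lee_fin => V0 h.
apply: (@le_trans _ _ (V^-1%:E * ((2^-1 ^+ d)%:E * V%:E))%E).
  by rewrite lee_wpmul2l// lee_fin invr_ge0.
rewrite -!EFinM lee_fin mulrCA ler_piMr ?exprn_ge0//.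
(* Since 0^-1 = 0 by convention, V^-1 V is either 0 or 1. *)
by have [->|V1] := eqVneq V 0; [rewrite mulr0|rewrite mulVf].
Qed.

(** This passes from a bound for every fixed x to a random X. Factorization on rectangles identifies
    the joint law with the product of the two laws, so the probability is the integral, over the law
    of [X], of the probabilities that [Y] lies in the section of [A]. *)
Lemma independent_pair_le X Y (A : set (d.-tuple R * d.-tuple R)) (e : R) :
  (forall B C, measurable B -> measurable C ->
    P ((X @^-1` B) `&` (Y @^-1` C)) = (P (X @^-1` B) * P (Y @^-1` C))%E) ->
  measurable A ->
  (forall x, P (Y @^-1` (xsection A x)) <= e%:E)%E ->
  (P [set w | A (X w, Y w)] <= e%:E)%E.
Proof.
move=> XY mA Ae.
pose Z w := (X w, Y w).
have mZ : measurable_fun setT Z by apply/measurable_fun_pairP; split.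
pose Z' : {RV P >-> (d.-tuple R * d.-tuple R)%type} :=
  HB.pack Z (isMeasurableFun.Build _ _ _ _ _ mZ).
have -> : P [set w | A (X w, Y w)] = (distribution P X \x distribution P Y)%E A.
  by rewrite (@product_measure_unique _ _ _ _ _ _ _ (distribution P Z'))//.
rewrite /product_measure1.
apply: (@le_trans _ _ (\int[distribution P X]_x e%:E)%E).
  apply: ge0_le_integral => //.
  - exact: measurable_fun_xsection.
  - by move=> x _; exact: Ae.
by rewrite integral_cst// -[leRHS]mule1 -(probability_setT P).
Qed.

End random_points.

Theorem corollary2 (R : realType) (d n : nat) (r theta : R)
    (dO : measure_display) (Omega : measurableType dO)
    (P : probability Omega R) (X : 'I_n -> {RV P >-> d.-tuple R}) :
  (1 <= d)%N -> (1 <= n)%N ->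
  0 <= r < 1 -> 0 < theta < 1 ->
  n%:R < Num.sqrt (theta * 2 ^+ d) ->
  mutually_independent X ->
  (forall i, uniform_on (layer r) (X i)) ->
  ((1 - theta)%:E < P [set w | linearly_separable (fun i => X i w)])%E.
Proof.
move=> d0 n0 r01 /andP[theta0 _] ntheta indepX unifX.
set S := [set w | _].
have mS : measurable S by exact: measurable_linearly_separable.
(* With i != j built into the event, the diagonal events are empty and the union can run over all
   n^2 ordered pairs. *)
pose E (i j : 'I_n) := [set w | i != j /\ thales (X j w) (X i w)].
have mE i j : measurable (E i j).
  have [->|ij] := eqVneq i j.
    rewrite (_ : E j j = set0)//.
    by apply/seteqP; split => // w []; rewrite eqxx.
  rewrite (_ : E i j = [set w | dotp (X i w) (X i w) <= dotp (X j w) (X i w)]).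
    apply: measurable_bool_set.
    by apply: measurable_fun_ler; exact: measurable_dotp.
  by apply/seteqP; split => w // [].
have PE i j : (P (E i j) <= (2^-1 ^+ d)%:E)%E.
  have [->|ij] := eqVneq i j.
    rewrite (_ : E j j = set0) ?measure0 ?lee_fin ?exprn_ge0//.
    by apply/seteqP; split => // w []; rewrite eqxx.
  (* The volume bound for [thales x] requires x in the unit ball. Adding this condition to [A] makes
     the sections at other x empty, at the cost of the null event that [X j] leaves the ball. *)
  pose A := [set z : d.-tuple R * d.-tuple R | eball 1 z.1 /\ thales z.1 z.2].
  have mA : measurable A.
    rewrite (_ : A = (fst @^-1` eball 1) `&`
      [set z : d.-tuple R * d.-tuple R | dotp z.2 z.2 <= dotp z.1 z.2])//.
    apply: measurableI.
      rewrite -[X in measurable X]setTI; apply: measurable_fst => //.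
      exact: measurable_eball.
    apply: measurable_bool_set.
    by apply: measurable_fun_ler; exact: measurable_dotp.
  have mout : measurable (X j @^-1` ~` eball 1).
    by apply: measurable_funPTI; apply: measurableC; exact: measurable_eball.
  have mAX : measurable [set w | A (X j w, X i w)].
    rewrite -[X in measurable X]setTI.
    have /(_ measurableT A mA) : measurable_fun setT (fun w => (X j w, X i w)).
      by apply/measurable_fun_pairP; split.
    exact.
  apply: (@le_trans _ _
      (P ([set w | A (X j w, X i w)] `|` X j @^-1` ~` eball 1))).
    apply: le_measure; rewrite ?inE//; first exact: measurableU.
    move=> w [_ Tw]; have [Bw|Bw] := pselect (eball 1 (X j w)).
      by left.
    by right.
  apply: (le_trans (measureU2 _ _ _)) => //.
  have -> : (P [set w | A (X j w, X i w)] + P (X j @^-1` ~` eball 1) =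
             P [set w | A (X j w, X i w)])%E.
    by rewrite (uniform_on_layer_eball _ _ (unifX j)) adde0.
  apply: independent_pair_le => //.
    move=> B C mB mC.
    (* Mutual independence for the index set {i, j}, with [C] assigned to i and [B] to j, gives the
       factorization for the pair. *)
    have := indepX [set j; i]%SET (fun k => if k == i then C else B).
    rewrite big_setU1 ?inE 1?eq_sym//= big_set1 eqxx (negbTE ij) => <-;
      last first.
      by move=> k; case: ifP.
    congr (P _); apply/seteqP; split => [w [Bw Cw] k /=|w h]; last first.
      split.
        by have := h j; rewrite /= !inE eqxx eq_sym (negbTE ij); exact.
      by have := h i; rewrite /= !inE eqxx orbT; exact.
    by rewrite !inE => /orP[|] /eqP ->; rewrite ?eqxx// eq_sym (negbTE ij).
  move=> x; have [x1|x1] := pselect (eball 1 x).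
    rewrite (_ : xsection A x = thales x).
      by apply: uniform_on_layer_thales (unifX i).
    by apply/seteqP; split => y; rewrite /xsection/= inE => -[].
  rewrite (_ : xsection A x = set0).
    by rewrite preimage_set0 measure0 lee_fin exprn_ge0.
  by apply/seteqP; split => y //; rewrite /xsection/= inE => -[].
have SE : ~` S `<=` \big[setU/set0]_(p : 'I_n * 'I_n) E p.1 p.2.
  (* If X_i is not separable, the normal X_i in particular fails against some X_j with j != i. *)
  move=> w /existsNP[i].
  move=> /forallNP/(_ (X i w)) /existsNP[y].
  move=> /not_implyP[[j ji <-]] /negP; rewrite -leNgt => h.
  rewrite -bigcup_seq; exists (i, j); first by rewrite /= mem_index_enum.
  by split => /=; [rewrite eq_sym|rewrite /thales/= (dotpC (X j w))].
have : (P (~` S) <= (n%:R ^+ 2 * 2^-1 ^+ d)%:E)%E.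
  apply: (@le_trans _ _ (P (\big[setU/set0]_(p : 'I_n * 'I_n) E p.1 p.2))).
    apply: le_measure; rewrite ?inE//; first exact: measurableC.
    exact: bigsetU_measurable.
  apply: (le_trans (measure_bigsetU_le _ _ P _ _ _ (fun p => mE p.1 p.2))).
  apply: (@le_trans _ _ (\sum_(p : 'I_n * 'I_n) (2^-1 ^+ d)%:E)%E).
    by apply: lee_sum => p _; exact: PE.
  rewrite sumEFin sumr_const card_prod card_ord lee_fin.
  by rewrite -[leLHS]mulr_natl natrM expr2.
have : n%:R ^+ 2 * 2^-1 ^+ d < theta.
  rewrite exprVn ltr_pdivrMr ?exprn_gt0//.
  (* Squaring the hypothesis on n gives n^2 < theta 2^d. *)
  rewrite -(sqr_sqrtr (a := theta * 2 ^+ d)) ?mulr_ge0 ?exprn_ge0// ?ltW//.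
  by rewrite ltr_pXn2r ?nnegrE ?sqrtr_ge0.
have -> : P (~` S) = (1 - P S)%E by exact: probability_setC.
rewrite -(fineK (fin_num_measure P _ mS)) -EFinB lee_fin lte_fin; lra.
Qed.
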